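(* Let $n\ge 1$ be an integer and let $\lambda>-1/2$, $\lambda\neq 0$. Let $\varphi_{n,\lambda}$ be the normalized Turán function $$\varphi_{n,\lambda}(x)=\frac{\big[p_n^{(\lambda)}(x)\big]^2-p_{n-1}^{(\lambda)}(x)\,p_{n+1}^{(\lambda)}(x)}{1-x^2},$$ where $p_m^{(\lambda)}$ is the $m$-th ultraspherical polynomial normalized by $p_m^{(\lambda)}(1)=1$. If $-1/2<\lambda<0$, then $\varphi_{n,\lambda}$ is concave on $\mathbb{R}$. If $\lambda>0$, then $\varphi_{n,\lambda}$ is convex on $\mathbb{R}$.
   Context: For $\lambda>-1/2$, $\lambda\ne 0$, $P_m^{(\lambda)}$ ($m=0,1,2,\dots$) denotes the $m$-th ultraspherical (Gegenbauer) polynomial, given by the generating function $(1-2xt+t^2)^{-\lambda}=\sum_{m\ge 0}P_m^{(\lambda)}(x)t^m$. The normalized polynomial is $p_m^{(\lambda)}(x)=P_m^{(\lambda)}(x)/P_m^{(\lambda)}(1)$, so that $p_m^{(\lambda)}(1)=1$. The Turán determinant is $\Delta_{n,\lambda}(x)=\big[p_n^{(\lambda)}(x)\big]^2-p_{n-1}^{(\lambda)}(x)p_{n+1}^{(\lambda)}(x)$, and $\varphi_{n,\lambda}(x)=\Delta_{n,\lambda}(x)/(1-x^2)$. Since $\Delta_{n,\lambda}(\pm1)=0$, the polynomial $\Delta_{n,\lambda}$ is divisible by $1-x^2$, and $\varphi_{n,\lambda}$ is understood as the resulting polynomial, defined on all of $\mathbb{R}$ (including $x=\pm1$). Convex and concave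 are meant in the usual non-strict sense. *)

(* Defs.v *)
From mathcomp Require Import all_boot all_order all_algebra.
From mathcomp Require Import all_classical all_reals all_analysis.

Set Implicit Arguments.
Unset Strict Implicit.
Unset Printing Implicit Defensive.

Import Order.TTheory GRing.Theory Num.Theory.
Import numFieldNormedType.Exports.

Local Open Scope classical_set_scope.
Local Open Scope ring_scope.

(* The generating function of the ultraspherical polynomials. For each real x
   the base 1 - 2xt + t^2 is positive for t near 0, so powR is the genuine real
   power there, and the power series in t determines every value (P m).[x],
   hence P itself. *)
Definition is_ultraspherical (R : realType) (lambda : R)
    (P : nat -> {poly R}) : Prop :=
  forall x : R, \forall t \near (0 : R),
    pseries (fun m => (P m).[x]) t @ \oo -->
      (1 - 2 * x * t + t ^+ 2) `^ (- lambda).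

Definition normalized (R : realType) (P : nat -> {poly R}) (m : nat) : {poly R} :=
  (P m).[1]^-1 *: P m.

Definition turan_det (R : realType) (p : nat -> {poly R}) (n : nat) : {poly R} :=
  p n ^+ 2 - p n.-1 * p n.+1.

(* Quotient in {poly R}; it is exact for the Turan determinant of the normalized
   ultraspherical polynomials, which vanishes at 1 and -1. *)
Definition turan_fun (R : realType) (p : nat -> {poly R}) (n : nat) : {poly R} :=
  turan_det p n %/ (1 - 'X^2).

Definition concave_function (R : realType) (D : set R^o) (f : R^o -> R^o) : Prop :=
  convex_function D (fun x => - f x).

(* Main.v *)
(* Write a = 2 lambda + 1, N = n (n + 2 lambda), y = p_n and s = x^2. From the
   structure relations, N phi = N y^2 - 2 lambda x y y' + (1 - x^2) y'^2, and the
   differential equation of y turns this into N phi'' = 2 lambda D with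
   D = x y' y'' - 2 y y'' - x y y'''; it remains to see that D >= 0 on R.

   Eliminating y'' and y''', (1 - s)^2 D is a quadratic form in (y, y') which is
   nonnegative as soon as s < 1 and G(s) = 4 N (1 - s) (2 + a s) -
   a (3 + (a - 1) s)^2 >= 0.  On the other hand, if s exceeds the squares of all
   the roots r of y (which are real, simple, and symmetric about 0) and
   v_r = s / (s - r^2), u = sum v_r, then
   s D / y^2 = 2 sum_r v_r (v_r - 1) (2 u + 1 - 4 v_r) >= 0, because r and -r
   both contribute to u.  Laguerre's inequality at a root r of y bounds r^2 well
   enough that every s not above all the r^2 satisfies G(s) >= 0, so the two
   regimes cover the line. *)
Require Import Defs.
From mathcomp Require Import all_boot all_order all_algebra.
From mathcomp Require Import all_classical all_reals all_analysis.
From mathcomp Require Import complex ring lra zify.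

Set Implicit Arguments.
Unset Strict Implicit.
Unset Printing Implicit Defensive.

Import Order.TTheory GRing.Theory Num.Theory.
Import numFieldNormedType.Exports.

Local Open Scope classical_set_scope.
Local Open Scope ring_scope.

Lemma subr1Xn2_neq0 (R : idomainType) : 1 - 'X^2 != 0 :> {poly R}.
Proof.
rewrite subr_eq0 eq_sym; apply/eqP => /(congr1 (coefp 0)).
by rewrite /coefp coefXn coef1 => /eqP; rewrite eq_sym oner_eq0.
Qed.

Lemma poly_horner_inj (R : numDomainType) (p q : {poly R}) :
  (forall x, p.[x] = q.[x]) -> p = q.
Proof.
move=> pq; apply/eqP; rewrite -subr_eq0; apply/negPn/negP => d0.
pose s := [seq i%:R : R | i <- iota 0 (size (p - q))].
have s_roots : all (root (p - q)) s.
  by apply/allP => x _; rewrite rootE !hornerE pq subrr.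
have s_uniq : uniq s.
  by rewrite map_inj_uniq ?iota_uniq // => i j /eqP; rewrite eqr_nat => /eqP.
by have := max_poly_roots d0 s_roots s_uniq; rewrite size_map size_iota ltnn.
Qed.

(** * Polynomials with real roots *)

Section RootSums.
Variable R : realFieldType.
Implicit Types (rs : seq R) (x c : R).

Definition inv_sum rs x k : R := \sum_(r <- rs) (x - r)^-1 ^+ k.

(** Away from the roots, q'/q = S_1 and S_k' = - k S_{k+1}. *)
Lemma prod_XsubC_derivs rs x : x \notin rs ->
  let q := \prod_(r <- rs) ('X - r%:P) in
  let S := inv_sum rs x in
  [/\ q.[x] != 0, q^`().[x] = q.[x] * S 1%N,
      q^`()^`().[x] = q.[x] * (S 1%N ^+ 2 - S 2%N) &
      q^`()^`()^`().[x] = q.[x] * (S 1%N ^+ 3 - 3 * S 1%N * S 2%N + 2 * S 3%N)].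
Proof.
rewrite /inv_sum; elim: rs => [|r rs IH] /=.
  by rewrite !big_nil !poly.derivE !hornerE; split; rewrite ?oner_neq0 //; ring.
rewrite inE negb_or => /andP[xr /IH []]; rewrite !big_cons.
set q := \prod_(_ <- _) _; set S1 := bigop _ _ _; set S2 := bigop _ _ _.
set S3 := bigop _ _ _ => q0 q1 q2 q3.
have xr0 : x - r != 0 by rewrite subr_eq0.
split.
- by rewrite hornerM hornerXsubC mulf_neq0.
- by rewrite !poly.derivE !hornerE /= q1; field.
- by rewrite !poly.derivE !hornerE /= q1 q2; field.
- by rewrite !poly.derivE !hornerE /= q1 q2 q3; field.
Qed.

(** Cauchy-Schwarz against the constant vector 1. *)
Lemma sum_sqr_le (s : seq R) (f : R -> R) :
  (\sum_(r <- s) f r) ^+ 2 <= (size s)%:R * \sum_(r <- s) f r ^+ 2.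
Proof.
elim: s => [|r s IH]; first by rewrite !big_nil mul0r expr0n.
rewrite !big_cons /= -natr1; move: IH.
set A := \sum_(_ <- _) _; set B := \sum_(_ <- _) _ => IH.
have B0 : 0 <= B by rewrite /B sumr_ge0 // => i _; rewrite sqr_ge0.
case: s @A @B IH B0 => [|r' s] A B IH B0.
  by rewrite /A /B !big_nil /= mulr0n add0r mul1r !addr0.
have m0 : 0 < (size (r' :: s))%:R :> R by rewrite ltr0n.
move: m0 IH; set m := _%:R => m0 IH.
suff : 0 <= m * f r ^+ 2 + B - 2 * f r * A by nra.
rewrite -(pmulr_rge0 _ m0).
have -> : m * (m * f r ^+ 2 + B - 2 * f r * A) =
  (m * f r - A) ^+ 2 + (m * B - A ^+ 2) by ring.
by rewrite addr_ge0 ?sqr_ge0 // subr_ge0.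
Qed.

(** With c (X - r) Q for the polynomial, its derivatives at r are c Q, 2 c Q' and 3 c Q''. Dividing
    by Q(r)^2 leaves the Cauchy-Schwarz inequality S_1^2 <= m S_2 over the m roots of Q. *)
Lemma laguerre_root (r c : R) rs : r \notin rs ->
  let q := c *: \prod_(t <- r :: rs) ('X - t%:P) in
  4 * (size rs)%:R * q^`().[r] * q^`()^`()^`().[r] <=
  3 * ((size rs)%:R - 1) * q^`()^`().[r] ^+ 2.
Proof.
move=> /prod_XsubC_derivs []; rewrite big_cons /=.
set q := \prod_(_ <- _) _; set S := inv_sum _ _ => q0 q1 q2 q3.
rewrite !(poly.derivE, derivXsubC) !hornerE /= q1 q2 subrr !mul0r !addr0.
have := sum_sqr_le rs (fun t => (r - t)^-1); set m := (size rs)%:R.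
rewrite -/(S 2%N) => h.
have {}h : S 1%N ^+ 2 <= m * S 2%N by [].
rewrite -subr_ge0.
set d := (X in 0 <= X).
have -> : d = 12 * (c * q.[r]) ^+ 2 * (m * S 2%N - S 1%N ^+ 2) by rewrite /d; ring.
by rewrite mulr_ge0 ?subr_ge0 // mulr_ge0 ?sqr_ge0 ?ler0n.
Qed.

Lemma symmetric_sum (rs : seq R) (f : R -> R) :
  perm_eq rs (map -%R rs) ->
  \sum_(r <- rs) f r = \sum_(r <- rs) ((f r + f (- r)) / 2).
Proof.
move=> s; have e : \sum_(r <- rs) f r = \sum_(r <- rs) f (- r).
  by rewrite (perm_big _ s) big_map.
by rewrite -mulr_suml big_split /= -e; field.
Qed.

Lemma beyond_roots (rs : seq R) c x :
  perm_eq rs (map -%R rs) -> (forall r, r \in rs -> r ^+ 2 < x ^+ 2) ->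
  let q := c *: \prod_(r <- rs) ('X - r%:P) in
  0 <= x * q^`().[x] * q^`()^`().[x] - 2 * q.[x] * q^`()^`().[x]
       - x * q.[x] * q^`()^`()^`().[x].
Proof.
(* At x = 0 the hypothesis leaves no root at all, so the polynomial is constant. *)
move=> sym lt_rs; have [x0|x0] := eqVneq x 0.
  rewrite x0 in lt_rs *.
  case: rs sym lt_rs => [_ _|r rs _ /(_ r (mem_head _ _))] /=.
    by rewrite big_nil !poly.derivE !hornerE /= !(mulr0, mul0r) !subr0.
  by rewrite expr0n ltNge sqr_ge0.
have xrs : x \notin rs by apply/negP => /lt_rs; rewrite ltxx.
have [] := prod_XsubC_derivs xrs; set q := \prod_(_ <- _) _ => q0 q1 q2 q3 /=.
rewrite !poly.derivE !hornerE /= q1 q2 q3.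
set S := inv_sum rs x in q1 q2 q3 *.
pose v r := x ^+ 2 / (x ^+ 2 - r ^+ 2); pose u := \sum_(r <- rs) v r.
have nz r : r \in rs -> [/\ x ^+ 2 - r ^+ 2 != 0, x - r != 0 & x + r != 0].
  move=> /lt_rs; rewrite -subr_gt0 => h; have n0 := lt0r_neq0 h.
  by move: (n0); rewrite {1}subr_sqr mulf_eq0 negb_or => /andP[].
(* Averaging over r and -r turns power sums of x / (x - r) into power sums of v. *)
have B1 : x * S 1%N = u.
  rewrite /S /inv_sum mulr_sumr symmetric_sum //.
  apply: eq_big_seq => r /nz [h1 h2 h3]; rewrite /v opprK; field.
  by rewrite h1 h2 h3.
have B2 : x ^+ 2 * S 2%N = \sum_(r <- rs) (2 * v r ^+ 2 - v r).
  rewrite /S /inv_sum mulr_sumr symmetric_sum //.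
  apply: eq_big_seq => r /nz [h1 h2 h3]; rewrite /v opprK; field.
  by rewrite h1 h2 h3.
have B3 : x ^+ 3 * S 3%N = \sum_(r <- rs) (4 * v r ^+ 3 - 3 * v r ^+ 2).
  rewrite /S /inv_sum mulr_sumr symmetric_sum //.
  apply: eq_big_seq => r /nz [h1 h2 h3]; rewrite /v opprK; field.
  by rewrite h1 h2 h3.
pose w := \sum_(r <- rs) (v r * (v r - 1) * (2 * u + 1 - 4 * v r)).
have w0 : 0 <= w.
  rewrite /w big_seq sumr_ge0 // => r rrs.
  have vge1 t : t \in rs -> 1 <= v t.
    move=> trs; have := lt_rs _ trs; rewrite -subr_gt0 => h.
    by rewrite /v ler_pdivlMr // mul1r gerBl sqr_ge0.
  have vr1 := vge1 _ rrs.
  (* A root 0 is its own mirror image and need not give two terms of [u]; its term of [w] vanishes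
     because [v r] = 1. *)
  have [r0|r0] := eqVneq r 0.
    have -> : v r = 1 by rewrite /v r0 expr0n subr0 divff // expf_neq0.
    by rewrite subrr mulr0 mul0r.
  have Nrrs : - r \in rs by rewrite (perm_mem sym) map_f.
  have Nrr : - r != r by rewrite eqNr.
  have vN : v (- r) = v r by rewrite /v sqrrN.
  (* [r] and [- r] are distinct entries with the same [v], and the other terms of [u] are
     nonnegative. *)
  have : 2 * v r <= u.
    have Nrem : - r \in rem r rs.
      by move: Nrrs; rewrite (perm_mem (perm_to_rem rrs)) inE (negPf Nrr).
    rewrite /u (perm_big _ (perm_to_rem rrs)) big_cons.
    rewrite (perm_big _ (perm_to_rem Nrem)) big_cons vN /=.
    have hh : 0 <= \sum_(j <- rem (- r) (rem r rs)) v j.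
      rewrite big_seq sumr_ge0 // => t /mem_rem /mem_rem /vge1; lra.
    lra.
  move=> uu; apply: mulr_ge0; last lra.
  by apply: mulr_ge0; lra.
(* The factor x^2 supplies a power x^k to each [S k]. *)
rewrite -(pmulr_rge0 _ (_ : 0 < x ^+ 2)); last by rewrite exprn_even_gt0.
set d := (X in 0 <= X).
have -> : d = 2 * (c * q.[x]) ^+ 2 * ((x * S 1%N) * (x ^+ 2 * S 2%N) -
    (x * S 1%N) ^+ 2 + x ^+ 2 * S 2%N - x ^+ 3 * S 3%N) by rewrite /d; ring.
rewrite B1 B2 B3.
set e := (X in _ * X).
(* One factor [u] is kept as a constant, so that u^2 is the sum of the [u * v r] and the two sums
   agree term by term. *)
have -> : e = w.
  rewrite /e /w [RHS](_ : _ = \sum_(r <- rs) (u * (2 * v r ^+ 2 - v r) -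
      u * v r + (2 * v r ^+ 2 - v r) - (4 * v r ^+ 3 - 3 * v r ^+ 2))).
    rewrite [RHS]sumrB [X in _ = X - _]big_split /=.
    by rewrite [X in _ = X + _ - _]sumrB -2!mulr_sumr expr2.
  by apply: eq_bigr => r _; ring.
by rewrite mulr_ge0 // mulr_ge0 ?sqr_ge0 ?ler0n.
Qed.

End RootSums.

(** * Solutions of the ultraspherical recurrence *)

(** Here m is the degree minus one: the hypothesis is the inequality that [root_bound] gives for s =
    r^2, and the conclusion contains G(s) >= 0 with N = (m + 1) (m + a). The product m G(s) is split
    into nonnegative terms, built from the slack [E] of the hypothesis and from [H]. *)
Lemma oscillatory_discriminant (R : realFieldType) (a m s : R) :
  0 < a -> 1 <= m -> 0 <= s ->
  a * ((m + 3) * a + 8 * m) * s <= 4 * m ^+ 2 * (m + 1 + a) * (1 - s) ->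
  s < 1 /\
  0 <= 4 * ((m + 1) * (m + a)) * (1 - s) * (2 + a * s) -
       a * (3 + (a - 1) * s) ^+ 2.
Proof.
move=> a0 m1 s0 hs; have m0 : 0 < m by lra.
set L := (m + 3) * a + 8 * m in hs; set K := 4 * m ^+ 2 * (m + 1 + a) in hs.
have L0 : 0 < L by rewrite /L addr_gt0 // mulr_gt0 //; lra.
have K0 : 0 < K by rewrite /K !mulr_gt0 ?exprn_gt0 //; lra.
have ma0 : 0 < m * a by rewrite mulr_gt0.
have s1 : s < 1.
  rewrite ltNge; apply/negP => s1.
  have h1 : 0 < a * L * s by rewrite !mulr_gt0 //; lra.
  have h2 : 0 <= K * (s - 1) by rewrite mulr_ge0 ?subr_ge0 // ltW.
  by lra.
split=> //; pose E := K * (1 - s) - a * L * s.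
have E0 : 0 <= E by rewrite /E subr_ge0.
(* H is affine in s and K H interpolates its values at the two ends s = 0 and
   E = 0 of the admissible range. *)
pose H := 2 * E - a * m + (6 * a ^+ 2 + 13 * m * a) * s.
have H0 : 0 <= H.
  rewrite -(pmulr_rge0 _ K0).
  have -> : K * H = (2 * K - a * m) * E + s * (m * a) *
      ((24 * m - (m + 3)) * a ^+ 2 + (24 * m * (m + 1) - 8 * m) * a +
       48 * m ^+ 2 * (m + 1 + a)) by rewrite /H /E /K /L; ring.
  apply: addr_ge0; apply: mulr_ge0 => //.
  - by rewrite /K; nra.
  - by rewrite mulr_ge0 // ltW.
  - apply: addr_ge0; first apply: addr_ge0; apply: mulr_ge0;
      rewrite ?sqr_ge0 //; try lra; try nra.
rewrite -(pmulr_rge0 _ m0).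
have -> : m * (4 * ((m + 1) * (m + a)) * (1 - s) * (2 + a * s) -
    a * (3 + (a - 1) * s) ^+ 2) =
  H + a * m * (s * (1 - s)) + s ^+ 2 * (3 * a ^+ 2 * a + 6 * m * a * a) +
  E * (a * s) by rewrite /H /E /K /L; ring.
have ? : 0 <= 1 - s by rewrite subr_ge0 ltW.
have ? : 0 <= a by rewrite ltW.
have ? : 0 <= m by rewrite ltW.
have ? : 0 <= s ^+ 2 * (3 * a ^+ 2 * a + 6 * m * a * a).
  rewrite mulr_ge0 ?sqr_ge0 // addr_ge0 //.
    by rewrite mulr_ge0 // mulr_ge0 ?sqr_ge0 ?ler0n.
  by rewrite mulr_ge0 // mulr_ge0 // mulr_ge0 ?ler0n.
by rewrite 3?addr_ge0 // !mulr_ge0.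
Qed.

(* Here y0, ..., y3 stand for the values at x of y, y', y'', y'''. *)
Lemma turan_quadratic_form (R : realFieldType) (a N x y0 y1 y2 y3 : R) :
  0 < a -> 0 < N -> x ^+ 2 < 1 ->
  (1 - x ^+ 2) * y2 = a * x * y1 - N * y0 ->
  (1 - x ^+ 2) * y3 = (a + 2) * x * y2 + (a - N) * y1 ->
  0 <= 4 * N * (1 - x ^+ 2) * (2 + a * x ^+ 2) -
       a * (3 + (a - 1) * x ^+ 2) ^+ 2 ->
  0 <= x * y1 * y2 - 2 * y0 * y2 - x * y0 * y3.
Proof.
move=> a0 N0 x1 h2 h3 G0.
have t0 : 0 < 1 - x ^+ 2 by rewrite subr_gt0.
have c0 : 0 < 2 + a * x ^+ 2.
  by rewrite ltr_wpDr ?ltr0n // mulr_ge0 ?sqr_ge0 // ltW.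
rewrite -(pmulr_rge0 _ (exprn_gt0 2 t0)).
have -> : (1 - x ^+ 2) ^+ 2 * (x * y1 * y2 - 2 * y0 * y2 - x * y0 * y3) =
  (1 - x ^+ 2) * (x * y1 - 2 * y0) * ((1 - x ^+ 2) * y2) -
  (1 - x ^+ 2) * x * y0 * ((1 - x ^+ 2) * y3) by ring.
rewrite h3.
have -> : (1 - x ^+ 2) * (x * y1 - 2 * y0) * ((1 - x ^+ 2) * y2) -
    (1 - x ^+ 2) * x * y0 * ((a + 2) * x * y2 + (a - N) * y1) =
  ((1 - x ^+ 2) * (x * y1 - 2 * y0) - (a + 2) * x ^+ 2 * y0) *
    ((1 - x ^+ 2) * y2) - (1 - x ^+ 2) * x * y0 * (a - N) * y1 by ring.
rewrite h2.
(* Completing the square in [y0]: this factor is four times the coefficient of y0^2. *)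
have M0 : 0 < 4 * N * (2 + a * x ^+ 2) by rewrite !mulr_gt0.
rewrite -(pmulr_rge0 _ M0).
set F := (X in 0 <= X).
have -> : F = (2 * N * (2 + a * x ^+ 2) * y0 -
               a * x * (3 + (a - 1) * x ^+ 2) * y1) ^+ 2 +
    (x * y1) ^+ 2 * a * (4 * N * (1 - x ^+ 2) * (2 + a * x ^+ 2) -
       a * (3 + (a - 1) * x ^+ 2) ^+ 2) by rewrite /F; ring.
by rewrite addr_ge0 ?sqr_ge0 // mulr_ge0 // mulr_ge0 ?sqr_ge0 // ltW.
Qed.

Section Recurrence.
Variables (R : rcfType) (lambda : R) (p : nat -> {poly R}).
Hypothesis lambda_gt : - (1 / 2) < lambda.
Hypothesis lambda_neq0 : lambda != 0.
Hypothesis p0 : p 0 = 1.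
Hypothesis p_rec : forall k,
  (k%:R + 2 * lambda%:P) * p k.+1 =
  2 * (k%:R + lambda%:P) * 'X * p k - k%:R * p k.-1.

Lemma natrD2lambda_gt0 k : (0 < k)%N -> 0 < k%:R + 2 * lambda.
Proof.
by move=> k0; have k1 : 1 <= k%:R :> R; [rewrite ler1n|move: lambda_gt => lgt; lra].
Qed.

(** The case k = 0 rests on lambda being nonzero, the others on lambda > -1/2. *)
Lemma natrD2lambda_neq0 k : k%:R + 2 * lambda != 0.
Proof.
case: k => [|k]; last by rewrite gt_eqF // natrD2lambda_gt0.
by rewrite add0r mulf_neq0 // pnatr_eq0.
Qed.

Lemma natrD2lambdaP_neq0 k : k%:R + 2 * lambda%:P != 0 :> {poly R}.
Proof.
have := natrD2lambda_neq0 k; apply: contra => /eqP e; apply/eqP.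
by apply: polyC_inj; rewrite polyCD polyCM !polyC_natr e.
Qed.

Lemma p1E : p 1 = 'X.
Proof.
have := p_rec 0; rewrite p0 !mulr0n add0r mul0r subr0 mulr1.
move=> e; apply: (mulfI (natrD2lambdaP_neq0 0)).
by rewrite mulr0n add0r e add0r.
Qed.

(* The second equation keeps the factor n, so that it is vacuous for n = 0, where
   n.-1 is junk. *)
Lemma deriv_down_up n :
  (1 - 'X^2) * (p n)^`() = n%:R * (p n.-1 - 'X * p n) /\
  n%:R * ((1 - 'X^2) * (p n.-1)^`()) =
    n%:R * ((n%:R - 1 + 2 * lambda%:P) * ('X * p n.-1 - p n)).
Proof.
elim: n => [|n [A C]]; first by rewrite p0 /= !mul0r derivC mulr0.
have r := p_rec n.
(* [B] trades p_{n-1} for p_{n+1} in [A]; up to the factor n + 1 it is the second equation at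
   [n.+1]. *)
have B : (1 - 'X^2) * (p n)^`() =
         (n%:R + 2 * lambda%:P) * ('X * p n - p n.+1).
  by rewrite A [RHS]mulrBr r; ring.
split; last by rewrite /= B -natr1 addrK.
apply: (mulfI (natrD2lambdaP_neq0 n)) => /=.
(* In the differentiated recurrence, p_{n-1}' carries the factor n, which is the form that [C]
   controls. *)
have dr : (n%:R + 2 * lambda%:P) * (p n.+1)^`() =
    2 * (n%:R + lambda%:P) * (p n + 'X * (p n)^`()) - n%:R * (p n.-1)^`().
  have := congr1 deriv r.
  rewrite !(poly.derivE, derivM, derivX, derivC) !(mul0rn, mulr0, mul0r, add0r).
  by move=> ->; ring.
rewrite mulrCA dr -natr1.
have -> : (1 - 'X^2) *
    (2 * (n%:R + lambda%:P) * (p n + 'X * (p n)^`()) - n%:R * (p n.-1)^`()) =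
  (1 - 'X^2) * (2 * (n%:R + lambda%:P)) * p n +
    2 * (n%:R + lambda%:P) * 'X * ((1 - 'X^2) * (p n)^`())
   - n%:R * ((1 - 'X^2) * (p n.-1)^`()) by ring.
rewrite C B.
have -> : n%:R * ((n%:R - 1 + 2 * lambda%:P) * ('X * p n.-1 - p n)) =
  (n%:R - 1 + 2 * lambda%:P) * ('X * (2 * (n%:R + lambda%:P) * 'X * p n -
     (2 * (n%:R + lambda%:P) * 'X * p n - n%:R * p n.-1)) - n%:R * p n) by ring.
by rewrite -r; ring.
Qed.

(** Differentiate the first relation of [deriv_down_up], multiply by 1 - X^2, eliminate p_{n-1}' by
    the second relation and p_{n-1} by the first, then cancel 1 - X^2. *)
Lemma ode n :
  (1 - 'X^2) * (p n)^`()^`() =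
  (2 * lambda%:P + 1) * 'X * (p n)^`() - n%:R * (n%:R + 2 * lambda%:P) * p n.
Proof.
have [A C] := deriv_down_up n.
have nz : (1 - 'X^2 : {poly R}) != 0 := subr1Xn2_neq0 R.
have dA : (1 - 'X^2) * (p n)^`()^`() =
    n%:R * ((p n.-1)^`() - p n - 'X * (p n)^`()) + 2 * 'X * (p n)^`().
  have := congr1 deriv A.
  rewrite !(poly.derivE, derivM, derivX, derivC) !(mul0rn, mul0r, add0r, mul1r).
  by move/(canRL (addKr _)) => ->; ring.
apply: (mulfI nz); rewrite dA.
have -> : (1 - 'X^2) * (n%:R * ((p n.-1)^`() - p n - 'X * (p n)^`()) +
    2 * 'X * (p n)^`()) =
  n%:R * ((1 - 'X^2) * (p n.-1)^`()) - n%:R * (1 - 'X^2) * p n +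
  (2 - n%:R) * 'X * ((1 - 'X^2) * (p n)^`()) by ring.
rewrite C.
have -> : n%:R * ((n%:R - 1 + 2 * lambda%:P) * ('X * p n.-1 - p n)) =
  (n%:R - 1 + 2 * lambda%:P) * ('X * (n%:R * (p n.-1 - 'X * p n)) +
    n%:R * ('X * 'X * p n - p n)) by ring.
by rewrite -A; ring.
Qed.

Lemma root_real n (z : R[i]) :
  root (map_poly (real_complex R) (p n)) z -> z^* = z.
Proof.
pose c := real_complex R lambda; pose f k := (map_poly (real_complex R) (p k)).[z].
have cE : c^* = c by exact: conjc_real.
have f_rec k : (k%:R + 2 * c) * f k.+1 = 2 * (k%:R + c) * z * f k - k%:R * f k.-1.
  have := congr1 (fun q => (map_poly (real_complex R) q).[z]) (p_rec k).
  rewrite !(rmorphM, rmorphB, rmorphD) /= !map_polyC map_polyX !rmorph_nat.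
  by rewrite !hornerE -/(f k) -/(f k.+1) -/(f k.-1) ?hornerMn ?hornerC.
have fc_rec k : (k%:R + 2 * c) * (f k.+1)^* =
    2 * (k%:R + c) * z^* * (f k)^* - k%:R * (f k.-1)^*.
  have := congr1 (fun w : R[i] => w^*) (f_rec k).
  by rewrite !(rmorphM, rmorphB, rmorphD, rmorph1) /= !rmorph_nat cE.
have f0 : f 0 = 1 by rewrite /f p0 rmorph1 hornerC.
have k2c_gt0 k : 0 < k.+1%:R + 2 * c.
  have := natrD2lambda_gt0 (ltn0Sn k).
  by rewrite -ltcR rmorphD rmorphM !rmorph_nat.
have kc_gt0 k : 0 < k.+1%:R + c.
  have h : 0 < k.+1%:R + lambda.
    by have k1 : 1 <= k.+1%:R :> R; [rewrite ler1n|move: lambda_gt => lgt; lra].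
  by move: h; rewrite -ltcR rmorphD rmorph_nat.
(* Christoffel-Darboux: S is a positive combination of the |p_j(z)|^2, j <= k. *)
have W k : exists2 S, 0 < S & f k.+1 * (f k)^* - f k * (f k.+1)^* = (z - z^*) * S.
  elim: k => [|k [S S0 IH]].
    (* Index 0 is treated apart: its coefficient 2 lambda may be negative, and is only cancelled. *)
    exists 1; rewrite ?ltr01 // f0 rmorph1 !mulr1 mul1r.
    have c0 : 2 * c != 0.
      by rewrite mulf_neq0 ?pnatr_eq0 // fmorph_eq0.
    apply: (mulfI c0); have := f_rec 0; have := fc_rec 0.
    rewrite f0 rmorph1 !mul0r !subr0 !add0r !mulr1 mulrBr => -> ->.
    by ring.
  exists ((2 * (k.+1%:R + c) * `|f k.+1| ^+ 2 + k.+1%:R * S) / (k.+1%:R + 2 * c)).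
    rewrite divr_gt0 // ltr_wpDl ?mulr_gt0 ?ltr0n //.
    by rewrite !mulr_ge0 ?exprn_ge0 ?ler0n // ltW.
  have nz : k.+1%:R + 2 * c != 0 by rewrite gt_eqF.
  apply: (mulfI nz).
  have -> u v w t d : d * (u * v - w * t) = (d * u) * v - w * (d * t) :> R[i].
    by ring.
  rewrite f_rec fc_rec normCK /= [RHS]mulrC -[RHS]mulrA divfK //.
  have -> : (z - z^*) * (2 * (k.+1%:R + c) * (f k.+1 * (f k.+1)^*) + k.+1%:R * S) =
    (z - z^*) * (2 * (k.+1%:R + c) * (f k.+1 * (f k.+1)^*)) +
    k.+1%:R * ((z - z^*) * S) by ring.
  by rewrite -IH; ring.
case: n => [|n]; first by rewrite p0 rmorph1 rootC oner_eq0.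
move/rootP; rewrite -/(f n.+1) => fn0; have [S S0] := W n.
rewrite fn0 conjC0 mul0r mulr0 subrr => /esym/eqP.
by rewrite mulf_eq0 [S == 0]gt_eqF // orbF subr_eq0 => /eqP.
Qed.

(** The polynomial splits over [R[i]]; its roots there have imaginary part 0, so taking real parts
    keeps the factorization. *)
Lemma real_rooted n :
  exists rs : seq R, p n = lead_coef (p n) *: \prod_(r <- rs) ('X - r%:P).
Proof.
have [zs zsE] := closed_field_poly_normal (map_poly (real_complex R) (p n)).
exists [seq complex.Re z | z <- zs].
apply: (map_poly_inj (real_complex R)).
rewrite map_polyZ rmorph_prod /= big_map -lead_coef_map {1}zsE.
congr (_ *: _); rewrite big_seq [RHS]big_seq; apply: eq_bigr => z zzs.
rewrite map_polyXsubC; congr ('X - _%:P).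
have : root (map_poly (real_complex R) (p n)) z.
  have /rootP zs0 : root (\prod_(w <- zs) ('X - w%:P)) z.
    by rewrite root_prod_XsubC.
  by rewrite zsE rootE hornerZ zs0 mulr0.
case: z zzs => a b _ /root_real /eqP; rewrite eq_complex /= => /andP[_].
by rewrite eqNr => /eqP ->.
Qed.

(** Read backwards, the recurrence would carry a common zero down to p_0 = 1. *)
Lemma no_common_root n x : root (p n) x -> root (p n.+1) x -> False.
Proof.
elim: n => [|n IH rn rn1]; first by rewrite p0 /root hornerC oner_eq0.
apply: IH => //; have := congr1 (horner^~ x) (p_rec n.+1).
rewrite !hornerE (rootP rn) (rootP rn1) !mulr0 sub0r => /esym/eqP.
by rewrite oppr_eq0 mulf_eq0 -polyC_natr hornerC pnatr_eq0 /=.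
Qed.

(** By the first relation of [deriv_down_up], a double root of p_n would also be a root of
    p_{n-1}. *)
Lemma root_simple n x : root (p n) x -> (p n)^`().[x] != 0.
Proof.
case: n => [|n rn]; first by rewrite p0 /root hornerC oner_eq0.
apply/eqP => d0; have [/(congr1 (horner^~ x))] := deriv_down_up n.+1.
rewrite !hornerE d0 (rootP rn) !mulr0 subr0 => /esym/eqP.
rewrite mulf_eq0 -polyC_natr hornerC pnatr_eq0 /= => rn1 _.
exact: no_common_root rn1 rn.
Qed.

Lemma parity n : p n \Po - 'X = (-1) ^+ n * p n.
Proof.
suff [] : p n \Po - 'X = (-1) ^+ n * p n /\
  p n.+1 \Po - 'X = (-1) ^+ n.+1 * p n.+1 by [].
elim: n => [|n [IH1 IH2]].
  by rewrite p1E p0 comp_polyX !rmorph1 expr1 mulN1r mul1r.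
split=> //; apply: (mulfI (natrD2lambdaP_neq0 n.+1)).
have := congr1 (comp_poly (- 'X)) (p_rec n.+1).
rewrite !(rmorphM, rmorphB, rmorphD, rmorph1) /= !comp_polyC comp_polyX.
rewrite !rmorph_nat IH1 IH2 => ->.
by rewrite [RHS]mulrCA p_rec /= !exprS; ring.
Qed.

(** For k >= 1 the recurrence multiplies the top coefficient by 2 (k + lambda) / (k + 2 lambda),
    which is positive. *)
Lemma coef_p n : (forall i, (n < i)%N -> (p n)`_i = 0) /\ (p n)`_n != 0.
Proof.
have H k i : (k%:R + 2 * lambda) * (p k.+1)`_i.+1 =
    2 * (k%:R + lambda) * (p k)`_i - k%:R * (p k.-1)`_i.+1.
  have := congr1 (fun q : {poly R} => q`_i.+1) (p_rec k).
  have -> : k%:R + 2 * lambda%:P = (k%:R + 2 * lambda)%:P :> {poly R}.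
    by ring.
  have -> : 2 * (k%:R + lambda%:P) * 'X * p k =
      (2 * (k%:R + lambda))%:P * (p k * 'X) :> {poly R}.
    by ring.
  by rewrite -polyC_natr coefB !coefCM coefMX.
suff [] : ((forall i, (n < i)%N -> (p n)`_i = 0) /\ (p n)`_n != 0) /\
  ((forall i, (n.+1 < i)%N -> (p n.+1)`_i = 0) /\ (p n.+1)`_n.+1 != 0) by [].
elim: n => [|n [[IH1 _] [IH2 IH3]]].
  rewrite p0 p1E; split; split => [[|i]|] //; rewrite ?coef1 ?coefX ?oner_eq0 //.
  by case: i.
split=> //; split=> [[//|i] ni|].
  apply: (mulfI (natrD2lambda_neq0 n.+1)).
  by rewrite H IH2 // IH1 ?mulr0 ?subr0 //; lia.
have := H n.+1 n.+1; rewrite /= IH1 // mulr0 subr0 => e.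
apply/eqP => e0; move: e; rewrite e0 mulr0 => /esym/eqP.
have h : 0 < n.+1%:R + lambda.
  by have k1 : 1 <= n.+1%:R :> R; [rewrite ler1n|move: lambda_gt => lgt; lra].
by rewrite !mulf_eq0 pnatr_eq0 (gt_eqF h) (negPf IH3).
Qed.

Lemma size_p n : size (p n) = n.+1.
Proof.
have [H0 Hn] := coef_p n; apply/eqP; rewrite eqn_leq; apply/andP; split.
  by apply/leq_sizeP.
by rewrite ltnNge; apply: contra Hn => /leq_sizeP ->.
Qed.

Let a := 2 * lambda + 1.

Lemma ode_horner n x :
  (1 - x ^+ 2) * (p n)^`()^`().[x] =
  a * x * (p n)^`().[x] - n%:R * (n%:R + 2 * lambda) * (p n).[x].
Proof.
have := congr1 (horner^~ x) (ode n).
by rewrite -!polyC_natr !hornerE /= => ->; rewrite /a; ring.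
Qed.

Lemma ode_deriv_horner n x :
  (1 - x ^+ 2) * (p n)^`()^`()^`().[x] =
  (a + 2) * x * (p n)^`()^`().[x] +
  (a - n%:R * (n%:R + 2 * lambda)) * (p n)^`().[x].
Proof.
have := congr1 (horner^~ x) (congr1 deriv (ode n)).
rewrite -!polyC_natr !(poly.derivE, derivM) !hornerE /= /a.
by move/(canRL (addKr _)) => ->; ring.
Qed.

(** Substituting - X in the factorization gives the sign (-1)^n times the product over the negated
    roots; by [parity] the signs cancel. *)
Lemma roots_symmetric n (rs : seq R) :
  p n = lead_coef (p n) *: \prod_(r <- rs) ('X - r%:P) ->
  perm_eq rs (map -%R rs).
Proof.
move=> pE; have c0 : lead_coef (p n) != 0.
  by rewrite lead_coef_eq0 -size_poly_gt0 size_p.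
have sz : size rs = n.
  by have := size_p n; rewrite pE size_scale // size_prod_XsubC => -[].
apply: prod_XsubC_eq; have := parity n; rewrite pE.
rewrite comp_polyZ -scalerAr => /(scalerI c0).
have -> : \prod_(r <- rs) ('X - r%:P) \Po - 'X =
    (-1) ^+ n * \prod_(r <- map -%R rs) ('X - r%:P).
  rewrite -{}sz; elim: rs {pE} => [|r rs IH].
    by rewrite !big_nil rmorph1 mulr1.
  rewrite !big_cons rmorphM /= IH comp_polyB comp_polyX comp_polyC exprS polyCN.
  by ring.
by move/(mulrI (unitrX _ (unitrN1 _))) => ->.
Qed.

(** Laguerre's inequality at r, with n other roots, is multiplied by (1 - r^2)^2. As y(r) = 0, the
    differential equation and its derivative make both sides multiples of y'(r)^2, which is
    positive. *)
Lemma root_bound n r : root (p n.+1) r ->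
  a * ((n%:R + 3) * a + 8 * n%:R) * r ^+ 2 <=
  4 * n%:R ^+ 2 * (n%:R + 1 + a) * (1 - r ^+ 2).
Proof.
move=> rr; have [rs pE] := real_rooted n.+1.
set c := lead_coef _ in pE.
have c0 : c != 0 by rewrite lead_coef_eq0 -size_poly_gt0 size_p.
have rrs : r \in rs.
  by move: rr; rewrite pE rootZ // root_prod_XsubC.
rewrite (perm_big _ (perm_to_rem rrs)) /= in pE.
have sz : size (rem r rs) = n.
  have := size_p n.+1; rewrite pE size_scale // size_prod_XsubC /=.
  by case.
have y1 := root_simple rr.
have rrem : r \notin rem r rs.
  rewrite -root_prod_XsubC; move: y1; apply: contraNN => /rootP h.
  rewrite pE big_cons !(poly.derivE, derivXsubC) !hornerE h subrr.
  by rewrite !(mulr0, mul0r) addr0 mulr0.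
have := laguerre_root c rrem; rewrite /= -pE sz.
have h2 := ode_horner n.+1 r; have h3 := ode_deriv_horner n.+1 r.
rewrite (rootP rr) mulr0 subr0 in h2.
move: y1 h2 h3; set y1 := _.[r]; set y2 := _.[r]; set y3 := _.[r] => y10 h2 h3 lag.
have : 4 * n%:R * y1 * (((1 - r ^+ 2)) * ((1 - r ^+ 2) * y3)) <=
       3 * (n%:R - 1) * ((1 - r ^+ 2) * y2) ^+ 2.
  have := ler_wpM2l (sqr_ge0 (1 - r ^+ 2)) lag.
  by congr (_ <= _); ring.
rewrite h3.
rewrite [X in X <= _](_ : _ = 4 * n%:R * y1 * ((a + 2) * r * ((1 - r ^+ 2) * y2) +
   (1 - r ^+ 2) * ((a - n.+1%:R * (n.+1%:R + 2 * lambda)) * y1))); last by ring.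
rewrite h2 -subr_ge0.
set d := (X in 0 <= X).
have y1p : 0 < y1 ^+ 2 by rewrite exprn_even_gt0.
have -> : d = y1 ^+ 2 * (4 * n%:R ^+ 2 * (n%:R + 1 + a) * (1 - r ^+ 2) -
   a * ((n%:R + 3) * a + 8 * n%:R) * r ^+ 2).
  by rewrite /d -natr1 /a; ring.
by rewrite pmulr_rge0 // subr_ge0.
Qed.

Lemma turan_curvature_ge0 n x : (0 < n)%N ->
  0 <= x * (p n)^`().[x] * (p n)^`()^`().[x] - 2 * (p n).[x] * (p n)^`()^`().[x]
       - x * (p n).[x] * (p n)^`()^`()^`().[x].
Proof.
case: n => [//|[|m]] _; first by rewrite p1E !poly.derivE !hornerE /= subr0 oppr0.
have m1 : 1 <= m.+1%:R :> R by rewrite ler1n.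
have a0 : 0 < a by move: lambda_gt => lgt; rewrite /a; lra.
have m0 : 0 < m.+1%:R :> R by rewrite ltr0n.
(* The split is at the threshold of [root_bound]: below it the quadratic form is nonnegative, above
   it x^2 exceeds every squared root. *)
case: (lerP (a * ((m.+1%:R + 3) * a + 8 * m.+1%:R) * x ^+ 2)
       (4 * m.+1%:R ^+ 2 * (m.+1%:R + 1 + a) * (1 - x ^+ 2))) => hx.
  have [x1 G0] := oscillatory_discriminant a0 m1 (sqr_ge0 x) hx.
  have N0 : 0 < (m.+1%:R + 1) * (m.+1%:R + a) by rewrite mulr_gt0 // addr_gt0.
  have NE : m.+2%:R * (m.+2%:R + 2 * lambda) = (m.+1%:R + 1) * (m.+1%:R + a).
    by rewrite /a -[m.+2%:R]natr1; ring.
  have := ode_horner m.+2 x; have := ode_deriv_horner m.+2 x; rewrite NE => h3 h2.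
  exact: turan_quadratic_form a0 N0 x1 h2 h3 G0.
have [rs pE] := real_rooted m.+2; rewrite pE; apply: beyond_roots.
  exact: roots_symmetric pE.
move=> r rrs; have rr : root (p m.+2) r.
  rewrite pE /root hornerZ mulf_eq0; apply/orP; right.
  by rewrite -/(root _ _) root_prod_XsubC.
(* The threshold inequality passes to smaller squares, so x^2 <= r^2 would transfer it from r to
   x. *)
have hr := root_bound rr; rewrite ltNge; apply/negP => xr.
have h1 : 0 <= a * ((m.+1%:R + 3) * a + 8 * m.+1%:R) * (r ^+ 2 - x ^+ 2).
  by rewrite mulr_ge0 ?subr_ge0 // mulr_ge0 ?ltW // addr_gt0 // mulr_gt0 //; lra.
have h2 : 0 <= 4 * m.+1%:R ^+ 2 * (m.+1%:R + 1 + a) * (r ^+ 2 - x ^+ 2).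
  by rewrite mulr_ge0 ?subr_ge0 // mulr_ge0 ?mulr_ge0 ?sqr_ge0 ?ler0n //; lra.
by lra.
Qed.

End Recurrence.

(** * Second derivatives and convexity of the Turán function *)

Lemma convex_horner (R : realType) (f : {poly R}) :
  (forall x, 0 <= f^`()^`().[x]) ->
  convex_function [set: R^o] (fun x : R^o => f.[x]).
Proof.
move=> f2 t.
have D1 (g : {poly R}) : 'D_1 (horner g) = horner g^`().
  by apply/funext => y; rewrite derivE derive1E.
have key (s : {i01 R}) (a b : R^o) : a <= b ->
    f.[conv s (a : convex_lmodType R^o) b] <= conv s (f.[a] : R^o) f.[b].
  apply: (@second_derivative_convex R (horner f) a b).
  - by move=> x _; have := f2 x; rewrite D1 -(congr1 (@^~ x) (D1 f^`())).
  - by apply: cvg_at_left_filter; exact: continuous_horner.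
  - by apply: cvg_at_right_filter; exact: continuous_horner.
  - by move=> x _; exact: derivable_horner.
  - by move=> x _; rewrite D1; exact: derivable_horner.
move=> x y _ _; have [xy|/ltW yx] := leP (x : R) y; first exact: key.
by rewrite convC [leRHS]convC; exact: key.
Qed.

Section TuranFunction.
Variables (R : realType) (lambda : R) (p : nat -> {poly R}).
Hypothesis lambda_gt : - (1 / 2) < lambda.
Hypothesis lambda_neq0 : lambda != 0.
Hypothesis p0 : p 0 = 1.
Hypothesis p_rec : forall k,
  (k%:R + 2 * lambda%:P) * p k.+1 =
  2 * (k%:R + lambda%:P) * 'X * p k - k%:R * p k.-1.

Lemma turan_fun_deriv2 n x : (0 < n)%N ->
  n%:R * (n%:R + 2 * lambda) * (turan_fun p n)^`()^`().[x] =
  2 * lambda * (x * (p n)^`().[x] * (p n)^`()^`().[x]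
    - 2 * (p n).[x] * (p n)^`()^`().[x] - x * (p n).[x] * (p n)^`()^`()^`().[x]).
Proof.
move=> n0; set N := n%:R * (n%:R + 2 * lambda).
have N0 : N != 0.
  by rewrite mulf_neq0 ?pnatr_eq0 ?(natrD2lambda_neq0 lambda_gt) // -lt0n.
have [A _] := deriv_down_up lambda_gt lambda_neq0 p0 p_rec n.
have r := p_rec n.
(* [psi] is N phi, found by expressing n p_{n-1} and (n + 2 lambda) p_{n+1} through p_n and p_n'. *)
pose psi := N%:P * p n ^+ 2 - 2 * lambda%:P * 'X * p n * (p n)^`() +
  (1 - 'X^2) * (p n)^`() ^+ 2.
have psiE : N *: turan_det p n = psi * (1 - 'X^2).
  rewrite -mul_polyC /turan_det.
  have -> : N%:P * (p n ^+ 2 - p n.-1 * p n.+1) =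
      N%:P * p n ^+ 2 - (n%:R * p n.-1) * ((n%:R + 2 * lambda%:P) * p n.+1).
    by rewrite /N; ring.
  rewrite r.
  have -> : 2 * (n%:R + lambda%:P) * 'X * p n - n%:R * p n.-1 =
     (n%:R + 2 * lambda%:P) * 'X * p n - n%:R * (p n.-1 - 'X * p n) by ring.
  have -> : n%:R * p n.-1 = n%:R * (p n.-1 - 'X * p n) + n%:R * 'X * p n by ring.
  by rewrite -A /psi /N; ring.
(* By [psiE] the Euclidean quotient in [turan_fun] is exact. *)
have fE : N *: turan_fun p n = psi.
  by rewrite /turan_fun -divpZl psiE mulpK // subr1Xn2_neq0.
(* The differential equation is used here, after one differentiation: it absorbs 1 - X^2 and cancels
   the terms in N. *)
have dpsi : psi^`() = 2 * lambda%:P *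
    ('X * (p n)^`() ^+ 2 - p n * (p n)^`() - 'X * p n * (p n)^`()^`()).
  have o := ode lambda_gt lambda_neq0 p0 p_rec n.
  have -> : psi^`() = 2 * N%:P * p n * (p n)^`() -
      2 * lambda%:P * (p n * (p n)^`() + 'X * (p n)^`() ^+ 2 +
        'X * p n * (p n)^`()^`()) - 2 * 'X * (p n)^`() ^+ 2 +
      2 * (p n)^`() * ((1 - 'X^2) * (p n)^`()^`()).
    by rewrite /psi !poly.derivE; ring.
  by rewrite o /N; ring.
have : (N *: turan_fun p n)^`()^`().[x] = psi^`()^`().[x] by rewrite fE.
rewrite !derivZ hornerZ dpsi => ->.
by rewrite !poly.derivE !hornerE /=; ring.
Qed.

Lemma turan_fun_convexity n : (0 < n)%N ->
  (lambda < 0 ->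
     concave_function [set: R^o] (fun x : R^o => (turan_fun p n).[x])) /\
  (0 < lambda ->
     convex_function [set: R^o] (fun x : R^o => (turan_fun p n).[x])).
Proof.
move=> n0.
have N0 : 0 < n%:R * (n%:R + 2 * lambda).
  by rewrite mulr_gt0 ?ltr0n // (natrD2lambda_gt0 lambda_gt).
have D0 x := turan_curvature_ge0 lambda_gt lambda_neq0 p0 p_rec x n0.
have E x := turan_fun_deriv2 x n0.
split=> l0.
  rewrite /concave_function; under eq_fun do rewrite -hornerN.
  apply: convex_horner => x; rewrite !derivN hornerN -(pmulr_rge0 _ N0) mulrN.
  by rewrite E -mulNr mulr_ge0 // oppr_ge0 pmulr_rle0 ?ltr0n // ltW.
apply: convex_horner => x; rewrite -(pmulr_rge0 _ N0) E.
by rewrite mulr_ge0 // mulr_ge0 ?ler0n // ltW.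
Qed.

End TuranFunction.

(** * From the generating function to the recurrence *)

Section PowerSeries.
Variable R : realType.
Implicit Types (c : R^nat) (f : R -> R).

(* The radius K / 4 leaves room for absorbing the factor n + 1 <= 2^n. *)
Lemma is_cvg_pseries_diffs c K : 0 < K -> cvgn (pseries c K) ->
  cvgn (pseries (pseries_diffs c) (K / 4)).
Proof.
move=> K0 cK; have [B [Breal Bc]] := cvg_series_bounded cK.
pose A := `|B + 1|.
have cA n : `|c n| * K ^+ n <= A.
  rewrite -[K in K ^+ _](ger0_norm (ltW K0)) -normrX -normrM.
  by apply: (Bc _ _ n) => //; rewrite (lt_le_trans _ (ler_norm _)) // ltrDl.
(* Since |c_n| K^n <= A, the terms are at most (A / K) (n + 1) / 4^n, hence at most (A / K) /
   2^n. *)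
apply: normed_cvg; apply: (@series_le_cvg _ _ (geometric (A / K) (1 / 2))).
- by move=> n; exact: normr_ge0.
- by move=> n; rewrite /geometric /= mulr_ge0 ?divr_ge0 ?exprn_ge0 ?normr_ge0 // ltW.
- move=> n /=; rewrite /pseries_diffs !normrM normrX normr_nat.
  rewrite [`|K / 4|]ger0_norm; last by rewrite divr_ge0 // ltW.
  have n2 : n.+1%:R <= 2 ^+ n :> R by rewrite -natrX ler_nat ltn_expl.
  have -> : n.+1%:R * `|c n.+1| * (K / 4) ^+ n =
      (n.+1%:R * (1 / 4) ^+ n) * ((`|c n.+1| * K ^+ n.+1) / K).
    have -> : K / 4 = K * (1 / 4) by rewrite mulrA mulr1.
    by rewrite exprS exprMn; field; rewrite gt_eqF.
  rewrite /geometric /= mulrC; apply: ler_pM.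
  + by rewrite divr_ge0 ?(ltW K0) // mulr_ge0 // exprn_ge0 // ltW.
  + by rewrite mulr_ge0 ?exprn_ge0.
  + by rewrite ler_wpM2r // invr_ge0 ltW.
  + have -> : 1 / 2 = 2 * (1 / 4) :> R by field.
    by rewrite [leRHS]exprMn ler_wpM2r // exprn_ge0.
- by apply: is_cvg_geometric_series; rewrite ger0_norm; lra.
Qed.

Lemma pseries_near0_derive c f :
  (\forall t \near (0 : R), pseries c t @ \oo --> f t) ->
  \forall t \near (0 : R), pseries (pseries_diffs c) t @ \oo --> 'D_1 f t.
Proof.
move=> cf; have [K /= K0 Kf] := (nbhs_ballP _ _).1 cf.
have {}Kf t : `|t| < K -> pseries c t @ \oo --> f t.
  by move=> tK; apply: Kf; rewrite /ball /= sub0r normrN.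
(* [L] lies strictly inside the ball. Termwise differentiation asks for convergence of two derived
   series, and each costs a factor 4. *)
pose L := K / 2.
have L0 : 0 < L by rewrite divr_gt0.
have c0 : cvgn (pseries c L).
  by apply: (cvgP (f L)); apply: Kf; rewrite gtr0_norm // /L; lra.
have L40 : 0 < L / 4 by rewrite divr_gt0.
have c1 := is_cvg_pseries_diffs L0 c0; have c2 := is_cvg_pseries_diffs L40 c1.
have L160 : 0 < L / 4 / 4 by rewrite divr_gt0.
near=> t.
have tL : `|t| < L / 4 / 4.
  near: t; apply/nbhs_ballP; exists (L / 4 / 4) => //= t.
  by rewrite /ball /= sub0r normrN.
have d : is_derive t 1 (fun t => limn (pseries c t)) (limn (pseries (pseries_diffs c) t)).
  apply: (@pseries_snd_diffs _ c (L / 4 / 4)) => //.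
  - by apply: is_cvg_pseries_inside c0 _; rewrite !gtr0_norm //; lra.
  - by apply: is_cvg_pseries_inside c1 _; rewrite !gtr0_norm //; lra.
  - by rewrite [ltRHS]gtr0_norm.
(* The function agrees with the sum of its series on a whole neighbourhood of t, so the derivatives
   agree. *)
have -> : 'D_1 f t = limn (pseries (pseries_diffs c) t).
  apply: (@derive_val _ _ _ _ _ _ _ (near_eq_is_derive _ d)).
  near=> s; apply: cvg_lim => //; apply: Kf.
  near: s; apply/nbhs_ballP; exists (K - `|t|) => /=.
    by rewrite subr_gt0 (lt_trans tL) // /L; lra.
  move=> s; rewrite /ball /= ltrBrDr; apply: le_lt_trans.
  by rewrite -[X in `|X|](subKr t) (le_trans (ler_normB _ _)) // addrC.
apply: is_cvg_pseries_inside c1 _.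
by rewrite (lt_trans tL) // [ltRHS]gtr0_norm //; lra.
Unshelve. all: by end_near.
Qed.

Lemma pseries0 c : pseries c 0 @ \oo --> c 0.
Proof.
rewrite -cvg_shiftS /= (_ : (fun n => _) = (fun=> c 0%N)); first exact: cvg_cst.
apply/funext => n; rewrite /pseries /series /= big_nat_recl // expr0 mulr1.
by rewrite big1 ?addr0 // => i _; rewrite expr0n mulr0.
Qed.

(** Evaluation at 0 gives c_0 = 0, and differentiation moves (n + 1) c_{n+1} to index n. *)
Lemma pseries_near0_eq0 c n :
  (\forall t \near (0 : R), pseries c t @ \oo --> (0 : R)) -> c n = 0.
Proof.
elim: n c => [|n IH] c c0.
  have h := nbhs_singleton c0.
  by rewrite -(cvg_lim _ (@pseries0 c)) // (cvg_lim _ h).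
have d0 : \forall t \near (0 : R), pseries (pseries_diffs c) t @ \oo --> (0 : R).
  by apply: filterS (pseries_near0_derive c0) => t; rewrite derive_cst.
have /eqP := IH _ d0.
by rewrite /pseries_diffs mulf_eq0 pnatr_eq0 => /eqP.
Qed.

Definition shift_coef c : R^nat := fun n => if n is m.+1 then c m else 0.

Lemma pseries_shift_coef c t l : pseries c t @ \oo --> l ->
  pseries (shift_coef c) t @ \oo --> t * l.
Proof.
move=> cl; rewrite -cvg_shiftS /=.
rewrite (_ : (fun n => _) = (fun n => t * pseries c t n)); last first.
  apply/funext => n; rewrite /pseries /series /= big_nat_recl //= mul0r add0r.
  by rewrite mulr_sumr; apply: eq_bigr => i _; rewrite exprS mulrCA.
exact: cvgMr.
Qed.

Lemma pseries_addZ c c' k t l l' :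
  pseries c t @ \oo --> l -> pseries c' t @ \oo --> l' ->
  pseries (fun n => c n + k * c' n) t @ \oo --> l + k * l'.
Proof.
move=> cl cl'.
rewrite (_ : pseries _ _ = (fun n => pseries c t n + k * pseries c' t n)).
  apply: cvgD => //; exact: cvgMr.
apply/funext => n; rewrite /pseries /series /= mulr_sumr -big_split /=.
by apply: eq_bigr => i _; rewrite mulrDl mulrA.
Qed.

End PowerSeries.

(** * Three-term recurrence and normalization at 1 *)

Section Ultraspherical.
Variables (R : realType) (lambda : R) (P : nat -> {poly R}).
Hypothesis PU : is_ultraspherical lambda P.

Lemma ultraspherical0 x : (P 0).[x] = 1.
Proof.
have h := nbhs_singleton (PU x).
have := cvg_lim (@Rhausdorff R) h.
rewrite (cvg_lim (@Rhausdorff R) (@pseries0 R (fun m => (P m).[x]))) => ->.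
by rewrite mulr0 subr0 expr0n addr0 powR1.
Qed.

(** Compare coefficients of t^n in (1 - 2xt + t^2) f' = 2 lambda (x - t) f, where f is the
    generating function. The default 0 stands for P_{-1}. *)
Lemma ultraspherical_rec x n :
  n.+1%:R * (P n.+1).[x] =
  2 * (n%:R + lambda) * x * (P n).[x] - (n%:R - 1 + 2 * lambda) *
    (if n is m.+1 then (P m).[x] else 0).
Proof.
pose c m := (P m).[x].
pose B t := 1 - 2 * x * t + t ^+ 2; pose f t := B t `^ (- lambda).
have cf : \forall t \near (0 : R), pseries c t @ \oo --> f t by exact: PU.
have cd := pseries_near0_derive cf.
pose Bp : {poly R} := 1 - (2 * x)%:P * 'X + 'X^2.
have BE : B = horner Bp by apply/funext => t; rewrite /B /Bp !hornerE.
have B0 : \forall t \near (0 : R), 0 < B t.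
  have B1 : B t @[t --> (0 : R)] --> B 0 by rewrite BE; exact: continuous_horner.
  by apply: (cvgr_gt _ B1); rewrite /B mulr0 subr0 expr0n addr0.
have df t : 0 < B t -> B t * 'D_1 f t = - lambda * (2 * t - 2 * x) * f t.
  move=> Bt.
  have dB : is_derive t 1 B (2 * t - 2 * x).
    rewrite BE; apply: is_derive_eq.
    by rewrite /Bp !poly.derivE !hornerE /=; ring.
  have dP := is_derive1_powR (- lambda) Bt.
  have d := is_derive1_comp dP dB.
  rewrite (@derive_val _ _ _ _ _ _ _ d).
  have -> : f t = B t * B t `^ (- lambda - 1).
    rewrite /f -[X in X * _](powRr1 (ltW Bt)) -powRD; last first.
      by rewrite (gt_eqF Bt) implybT.
    by congr (_ `^ _); ring.
  by ring.
(* g lists the coefficients of (1 - 2xt + t^2) f' + 2 lambda (t - x) f. *)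
pose S := @shift_coef R; pose dc := pseries_diffs c.
pose g m := dc m + (- (2 * x)) * S dc m + 1 * S (S dc) m
   + (2 * lambda) * S c m + (- (2 * lambda * x)) * c m.
have g0 : \forall t \near (0 : R), pseries g t @ \oo --> (0 : R).
  near=> t.
  have ct : pseries c t @ \oo --> f t by near: t.
  have dt : pseries dc t @ \oo --> 'D_1 f t by near: t.
  have Bt : 0 < B t by near: t.
  have -> : 0 = 'D_1 f t + (- (2 * x)) * (t * 'D_1 f t) +
      1 * (t * (t * 'D_1 f t)) + (2 * lambda) * (t * f t) +
      (- (2 * lambda * x)) * f t.
    have -> : 'D_1 f t + (- (2 * x)) * (t * 'D_1 f t) +
      1 * (t * (t * 'D_1 f t)) = B t * 'D_1 f t by rewrite /B; ring.
    by rewrite df //; ring.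
  by do !apply: pseries_addZ => //; do !apply: pseries_shift_coef.
have := pseries_near0_eq0 n g0.
rewrite /g /dc /S /pseries_diffs /shift_coef /c.
(* The double shift has default values at indices 0 and 1. *)
by case: n => [|[|n]] /= h; apply: subr0_eq; rewrite -[RHS]h; ring.
Unshelve. all: by end_near.
Qed.

(** This encodes P_n(1) = (2 lambda)_n / n!. At x = 1 the induction hypothesis turns the three-term
    recurrence into a two-term one. *)
Lemma horner1_rec n :
  n.+1%:R * (P n.+1).[1] = (n%:R + 2 * lambda) * (P n).[1].
Proof.
elim: n => [|n IH]; rewrite ultraspherical_rec; first by ring.
have -> : n.+1%:R - 1 = n%:R :> R by rewrite -natr1 addrK.
by rewrite -IH -natr1; ring.
Qed.

Hypothesis lambda_gt : - (1 / 2) < lambda.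
Hypothesis lambda_neq0 : lambda != 0.

Lemma horner1_neq0 n : (P n).[1] != 0.
Proof.
elim: n => [|n IH]; first by rewrite ultraspherical0 oner_neq0.
have : n.+1%:R * (P n.+1).[1] != 0.
  by rewrite horner1_rec mulf_neq0 // (natrD2lambda_neq0 lambda_gt).
by rewrite mulf_eq0 negb_or => /andP[].
Qed.

Lemma normalized0 : normalized P 0 = 1.
Proof.
by apply: poly_horner_inj => x; rewrite /normalized !hornerE !ultraspherical0 invr1 mulr1.
Qed.

(** The ratio P_{k+1}(1) / P_k(1) = (k + 2 lambda) / (k + 1) changes the outer coefficients k + 1
    and k - 1 + 2 lambda into k + 2 lambda and k. *)
Lemma normalized_rec k :
  (k%:R + 2 * lambda%:P) * normalized P k.+1 =
  2 * (k%:R + lambda%:P) * 'X * normalized P k - k%:R * normalized P k.-1.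
Proof.
apply: poly_horner_inj => x; rewrite /normalized -!polyC_natr !hornerE /=.
have e0 := horner1_neq0 k; have e1 := horner1_neq0 k.+1.
apply: (mulfI e0).
have -> : (P k).[1] * ((k%:R + 2 * lambda) / (P k.+1).[1] * (P k.+1).[x]) =
    k.+1%:R * (P k.+1).[x].
  apply: (mulfI e1).
  have -> : (P k.+1).[1] * (k.+1%:R * (P k.+1).[x]) =
      (k.+1%:R * (P k.+1).[1]) * (P k.+1).[x] by ring.
  by rewrite horner1_rec; field.
rewrite ultraspherical_rec mulrBr; congr (_ - _); first by field.
(* At k = 0 both sides vanish: the factor k removes [normalized P 0.-1], and P_{-1} is 0. *)
case: k e0 {e1} => [|k] e0; first by rewrite !mul0r !mulr0.
have e2 := horner1_neq0 k.
have -> : (P k.+1).[1] * (k.+1%:R / (P k).[1] * (P k).[x]) =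
    (k.+1%:R * (P k.+1).[1]) / (P k).[1] * (P k).[x] by ring.
by rewrite horner1_rec /= -natr1; field.
Qed.

End Ultraspherical.

Theorem theorem1p1 (R : realType) (n : nat) (lambda : R) (P : nat -> {poly R})
    (n_ge1 : (1 <= n)%N) (lambda_gt : - (1 / 2) < lambda)
    (lambda_neq0 : lambda != 0) (PU : is_ultraspherical lambda P) :
  (lambda < 0 ->
     concave_function [set: R^o]
       (fun x : R^o => (turan_fun (normalized P) n).[x])) /\
  (0 < lambda ->
     convex_function [set: R^o]
       (fun x : R^o => (turan_fun (normalized P) n).[x])).
Proof.
apply: turan_fun_convexity n_ge1 => //; first exact: normalized0 PU.
exact: normalized_rec PU lambda_gt lambda_neq0.
Qed.
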